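(* Let $\tau=2$. For every Leaf-level Network Requirement Matrix $L$ (of a cluster with parameters $P,K_{\mathrm{spine}},K_{\mathrm{leaf}},\tau=2$), the solution $(L_{abh})$ produced by the Heuristic-Decomposition algorithm satisfies $$\sum_{h} L_{abh}=L_{ab}\quad\text{for all leaves } a,b,$$ $$\sum_b L_{abh}\le 2 \quad\text{for all } a,h,\qquad \sum_a L_{abh}\le 2\quad\text{for all } b,h,$$ $$\sum_{a\in \text{Pod } i}\ \sum_{b\in \text{Pod } j} L_{abh}=\sum_{a\in \text{Pod } i}\ \sum_{b\in \text{Pod } j} L_{bah}\quad\text{for all Pods } i,j \text{ and all } h,$$ where $h$ ranges over $\{1,\dots,K_{\mathrm{leaf}}/2\}$. Equivalently, for every such $L$ there exists a logical topology under which $L$ can be scheduled without routing polarization, i.e. there exist nonnegative integers $L_{abh}$ satisfying all of these constraints, with logical topology $C_{ijh}=\sum_{a\in \text{Pod } i}\sum_{b\in \text{Pod } j}L_{abh}$.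
   Context: Cluster model. A cluster has parameters that are positive integers: $P$ (number of Pods), $K_{\mathrm{spine}}$, $K_{\mathrm{leaf}}$, and $\tau$ (number of parallel links between each leaf switch and each spine switch of the same Pod), with $\tau$ dividing $K_{\mathrm{spine}}$ and $K_{\mathrm{leaf}}$. Each Pod contains $K_{\mathrm{spine}}/\tau$ leaf switches (''leaves'') and $K_{\mathrm{leaf}}/\tau$ spine switches, indexed by $h\in\{1,\dots,K_{\mathrm{leaf}}/\tau\}$. The leaves of the whole cluster are thus a set of $\eta=PK_{\mathrm{spine}}/\tau$ elements partitioned into $P$ Pods of equal size. A Leaf-level Network Requirement Matrix is a symmetric $\eta\times\eta$ matrix $L=[L_{ab}]$ of nonnegative integers, indexed by pairs of leaves, with $L_{ab}=0$ whenever $a,b$ belong to the same Pod, and with $\sum_b L_{ab}\le K_{\mathrm{leaf}}$ for all $a$ and $\sum_a L_{ab}\le K_{\mathrm{leaf}}$ for all $b$. Heuristic-Decomposition algorithm (input $L$; put $H=K_{\mathrm{leaf}}/\tau$). Step 1. Compute a nonnegative integer matrix $A$ with $L=A+A^{T}$ and $$\Big\lfloor \tfrac{\sum_b L_{ab}}{2}\Big\rfloor\le\sum_b A_{ab}\le\Big\lceil \tfrac{\sum_b L_{ab}}{2}\Big\rceil\ \ \forall a,\qquad \Big\lfloor \tfrac{\sum_a L_{ab}}{2}\Big\rfloor\le\sum_a A_{ab}\le\Big\lceil \tfrac{\sum_a L_{ab}}{2}\Big\rceil\ \ \forall b.$$ (Such an $A$ exists by a known symmetric matrix decomposition theorem.)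 Step 2. Compute integer matrices $A^{(1)},\dots,A^{(H)}$ with $A=A^{(1)}+\cdots+A^{(H)}$ and, for all $a,b,h$, $$\Big\lfloor \tfrac{A_{ab}}{H}\Big\rfloor\le A^{(h)}_{ab}\le\Big\lceil \tfrac{A_{ab}}{H}\Big\rceil,\quad \Big\lfloor \tfrac{\sum_a A_{ab}}{H}\Big\rfloor\le \sum_a A^{(h)}_{ab}\le\Big\lceil \tfrac{\sum_a A_{ab}}{H}\Big\rceil,\quad \Big\lfloor \tfrac{\sum_b A_{ab}}{H}\Big\rfloor\le \sum_b A^{(h)}_{ab}\le\Big\lceil \tfrac{\sum_b A_{ab}}{H}\Big\rceil.$$ (Such matrices exist by a known integer matrix decomposition theorem.) Step 3. Output $L_{abh}=A^{(h)}_{ab}+A^{(h)}_{ba}$ and $C_{ijh}=\sum_{a\in \text{Pod } i}\sum_{b\in \text{Pod } j}L_{abh}$. The claim about the algorithm's solution is meant for every choice of $A$ and $A^{(1)},\dots,A^{(H)}$ with the stated properties. $C_{ijh}$ is the number of links between the $h$-th spine of Pod $i$ and the $h$-th spine of Pod $j$; ''without routing polarization'' means that the constraints $\sum_b L_{abh}\le\tau$ and $\sum_a L_{abh}\le\tau$ hold (together with the other two families of constraints). *)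

(* Defs.v *)
From HB Require Import structures.
From mathcomp Require Import all_boot all_order all_algebra.

Set Implicit Arguments.
Unset Strict Implicit.
Unset Printing Implicit Defensive.

Import Order.TTheory GRing.Theory Num.Theory.
Local Open Scope ring_scope.

Record cluster := Cluster {
  pods : nat;
  Kspine : nat;
  Kleaf : nat;
  tau : nat;
  pods_gt0 : (0 < pods)%N;
  Kspine_gt0 : (0 < Kspine)%N;
  Kleaf_gt0 : (0 < Kleaf)%N;
  tau_gt0 : (0 < tau)%N;
  tau_dvd_Kspine : (tau %| Kspine)%N;
  tau_dvd_Kleaf : (tau %| Kleaf)%N
}.

(* A leaf is a pair (Pod, position of the leaf inside its Pod). *)
Definition leaf (c : cluster) : finType :=
  ('I_(pods c) * 'I_(Kspine c %/ tau c))%type.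

Definition pod (c : cluster) (a : leaf c) : 'I_(pods c) := a.1.

(* The number H of spines in each Pod. *)
Definition nspine (c : cluster) : nat := (Kleaf c %/ tau c)%N.

Definition leaf_matrix (c : cluster) := leaf c -> leaf c -> int.

(* The type of the arrays (L_{abh}). *)
Definition leaf_spine_array (c : cluster) :=
  leaf c -> leaf c -> 'I_(nspine c) -> int.

(* The type of the arrays (C_{ijh}), where C_{ijh} is the number of links
   between the h-th spine of Pod i and the h-th spine of Pod j. *)
Definition logical_topology (c : cluster) :=
  'I_(pods c) -> 'I_(pods c) -> 'I_(nspine c) -> int.

Definition leaf_requirement (c : cluster) (L : leaf_matrix c) : Prop :=
  [/\ forall a b, 0 <= L a b,
      forall a b, L a b = L b a,
      forall a b, pod a = pod b -> L a b = 0,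
      forall a, \sum_b L a b <= (Kleaf c)%:Z
    & forall b, \sum_a L a b <= (Kleaf c)%:Z].

Definition between_floor_ceil (q : rat) (m : int) : bool :=
  Num.floor q <= m <= Num.ceil q.

Definition heuristic_step1 (c : cluster) (L A : leaf_matrix c) : Prop :=
  [/\ forall a b, 0 <= A a b,
      forall a b, L a b = A a b + A b a,
      forall a, between_floor_ceil ((\sum_b L a b)%:~R / 2%:R) (\sum_b A a b)
    & forall b, between_floor_ceil ((\sum_a L a b)%:~R / 2%:R) (\sum_a A a b)].

Definition heuristic_step2 (c : cluster) (A : leaf_matrix c)
    (Ah : 'I_(nspine c) -> leaf_matrix c) : Prop :=
  [/\ forall a b, A a b = \sum_h Ah h a b,
      forall a b h,
        between_floor_ceil ((A a b)%:~R / (nspine c)%:R) (Ah h a b),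
      forall b h,
        between_floor_ceil ((\sum_a A a b)%:~R / (nspine c)%:R)
                           (\sum_a Ah h a b)
    & forall a h,
        between_floor_ceil ((\sum_b A a b)%:~R / (nspine c)%:R)
                           (\sum_b Ah h a b)].

Definition heuristic_step3 (c : cluster)
    (Ah : 'I_(nspine c) -> leaf_matrix c) : leaf_spine_array c :=
  fun a b h => Ah h a b + Ah h b a.

(* The relation is nondeterministic: every admissible choice of the two
   decompositions counts as a run of the algorithm. *)
Definition heuristic_solution (c : cluster) (L : leaf_matrix c)
    (x : leaf_spine_array c) : Prop :=
  exists (A : leaf_matrix c) (Ah : 'I_(nspine c) -> leaf_matrix c),
    [/\ heuristic_step1 L A,
        heuristic_step2 A Ah
      & forall a b h, x a b h = heuristic_step3 Ah a b h].

Definition topology_of (c : cluster) (x : leaf_spine_array c) :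
    logical_topology c :=
  fun i j h => \sum_(a | pod a == i) \sum_(b | pod b == j) x a b h.

Definition unpolarized (c : cluster) (L : leaf_matrix c)
    (x : leaf_spine_array c) : Prop :=
  [/\ forall a b, \sum_h x a b h = L a b,
      forall a h, \sum_b x a b h <= (tau c)%:Z,
      forall b h, \sum_a x a b h <= (tau c)%:Z
    & forall i j h,
        \sum_(a | pod a == i) \sum_(b | pod b == j) x a b h =
        \sum_(a | pod a == i) \sum_(b | pod b == j) x b a h].

Definition schedulable_unpolarized (c : cluster) (L : leaf_matrix c)
    (C : logical_topology c) : Prop :=
  exists x : leaf_spine_array c,
    [/\ forall a b h, 0 <= x a b h,
        unpolarized L x
      & forall i j h, C i j h = topology_of x i j h].

(* Main.v *)
Require Import Defs.
From mathcomp Require Import all_boot all_order all_algebra.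
From mathcomp Require Import zify.

(** Orient the multigraph [L] so that in- and out-degrees differ by at most one
    at every vertex: as long as some vertex [v] has two outgoing edges [v -> u]
    and [v -> w], split them off into a single edge [u -> w], orient the smaller
    multigraph, and subdivide that edge again.  The resulting matrix has row and
    column sums at most [H], so by König's theorem it is a sum of [H] matrices
    with row and column sums at most one.  König's theorem follows by adding the
    edges one at a time: if the new edge [(a, b)] has colour [h] free at [a] and
    colour [k] free at [b], a balanced orientation of the bipartite multigraph
    formed by the colours [h], [k] and the new edge splits it into two matchings. *)

Set Implicit Arguments.
Unset Strict Implicit.
Unset Printing Implicit Defensive.

Import Order.TTheory GRing.Theory Num.Theory.
Local Open Scope ring_scope.

(** * Single-edge matrices and integer sums *)

Definition edge (V W : finType) (u : V) (w : W) (a : V) (b : W) : int :=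
  ((a == u) && (b == w))%:Z.

Lemma edge_ge0 (V W : finType) (u : V) (w : W) a b : 0 <= edge u w a b.
Proof. by []. Qed.

Lemma edgeC (V W : finType) (u : V) (w : W) a b : edge u w a b = edge w u b a.
Proof. by rewrite /edge andbC. Qed.

Lemma sum_edge_row (V W : finType) (u : V) (w : W) a :
  \sum_b edge u w a b = (a == u)%:Z.
Proof.
rewrite (bigD1 w) //= {1}/edge eqxx andbT big1 ?addr0 // => b /negbTE bw.
by rewrite /edge bw andbF.
Qed.

Lemma sum_edge_col (V W : finType) (u : V) (w : W) b :
  \sum_a edge u w a b = (b == w)%:Z.
Proof. by rewrite -(sum_edge_row w u b); apply: eq_bigr => a _; apply: edgeC. Qed.

Lemma sum_edge (V W : finType) (u : V) (w : W) :
  \sum_a \sum_b edge u w a b = 1.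
Proof.
rewrite (bigD1 u) //= sum_edge_row eqxx big1 ?addr0 // => a /negbTE au.
by rewrite sum_edge_row au.
Qed.

Lemma sub_edge_ge0 (V W : finType) (M : V -> W -> int) u w :
  (forall a b, 0 <= M a b) -> 0 < M u w -> forall a b, 0 <= M a b - edge u w a b.
Proof.
move=> M0 Muw a b; rewrite /edge.
have := M0 a b; have [->|_] := eqVneq a u; have [->|_] := eqVneq b w => /=; lia.
Qed.

(* [big_split] and [sumrB] at type [int], stated so that the sums they produce
   carry the same canonical instances as elaborated ones: [lia] compares them
   syntactically. *)
Lemma sumiD (I : finType) (f g : I -> int) :
  \sum_i (f i + g i) = \sum_i f i + \sum_i g i.
Proof. exact: big_split. Qed.

Lemma sumiB (I : finType) (f g : I -> int) :
  \sum_i (f i - g i) = \sum_i f i - \sum_i g i.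
Proof. exact: sumrB. Qed.

Lemma sum_gt0_ex (I : finType) (f : I -> int) : 0 < \sum_i f i -> exists i, 0 < f i.
Proof.
move=> sum_gt0; apply/existsP; apply: contraLR sum_gt0.
rewrite negb_exists => /forallP f_le0; rewrite -leNgt.
by apply: sumr_le0 => i _; rewrite leNgt.
Qed.

(** Pigeonhole; with [f] the degrees of a vertex in the colour classes, it yields a colour free at
    that vertex. *)
Lemma sum_lt_card_ex0 (I : finType) (f : I -> int) :
  (forall i, 0 <= f i) -> \sum_i f i < #|I|%:Z -> exists i, f i = 0.
Proof.
move=> f0 lt_f.
have [|i fi] := @sum_gt0_ex I (fun i => 1 - f i).
  by rewrite sumrB sumr_const subr_gt0 natz.
by exists i; have := f0 i; lia.
Qed.

(** * Balanced orientations of multigraphs *)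

Definition balanced (V : finType) (A : V -> V -> int) :=
  forall v, `|\sum_b A v b - \sum_a A a v| <= 1.

(** [M] serves as an arbitrary initial orientation of the multigraph, and the induction is on its
    number of edges. *)
Lemma balanced_orientation (V : finType) (M : V -> V -> int) :
  (forall a b, 0 <= M a b) ->
  exists A : V -> V -> int,
    [/\ forall a b, 0 <= A a b,
        forall a b, A a b + A b a = M a b + M b a
      & balanced A].
Proof.
have [n] := ubnP `|(\sum_a \sum_b M a b)%R|%N; elim: n M => // n IHn M.
(* Splitting off two edges leaving [v]; two edges entering [v] are handled
   by transposing [M]. *)
have split_off (N : V -> V -> int) v : (forall a b, 0 <= N a b) ->
    (`|(\sum_a \sum_b N a b)%R| < n.+1)%N -> 1 < \sum_b N v b ->
  exists A : V -> V -> int,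
    [/\ forall a b, 0 <= A a b,
        forall a b, A a b + A b a = N a b + N b a
      & balanced A].
  move=> N0 leN out_v.
  have [u Nvu] : exists u, 0 < N v u by apply: sum_gt0_ex; lia.
  have N'0 := sub_edge_ge0 N0 Nvu.
  have [w Nvw] : exists w, 0 < N v w - edge v u v w.
    by apply: sum_gt0_ex; rewrite sumiB sum_edge_row eqxx; lia.
  have N''0 := sub_edge_ge0 N'0 Nvw.
  pose N3 a b := N a b - edge v u a b - edge v w a b + edge u w a b.
  have N30 a b : 0 <= N3 a b by rewrite addr_ge0 ?edge_ge0.
  have sumN3 : \sum_a \sum_b N3 a b = \sum_a \sum_b N a b - 1.
    rewrite (eq_bigr (fun a => \sum_b N a b - \sum_b edge v u a b -
               \sum_b edge v w a b + \sum_b edge u w a b)); last first.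
      by move=> a _; rewrite sumiD !sumiB.
    by rewrite sumiD !sumiB !sum_edge subrK.
  have sumN_gt0 : 0 < \sum_a \sum_b N a b.
    rewrite (bigD1 v) //= ltr_wpDr ?sumr_ge0 //; last exact: lt_trans out_v.
    by move=> a _; apply: sumr_ge0.
  have [|A [A0 AN3 balA]] := IHn N3 _ N30; first by rewrite sumN3; lia.
  (* Here [(x, y)] is [(u, w)] or [(w, u)]. Rerouting one edge [x -> y] through [v] adds one to both
     degrees of [v] and keeps all others, so every difference is preserved. *)
  have subdivide x y : 0 < A x y ->
      (forall a b, edge x y a b + edge x y b a = edge u w a b + edge u w b a) ->
      (forall a b, edge x v a b + edge v y a b + edge x v b a + edge v y b a =
                   edge v u a b + edge v w a b + edge v u b a + edge v w b a) ->
    exists A' : V -> V -> int,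
    [/\ forall a b, 0 <= A' a b,
        forall a b, A' a b + A' b a = N a b + N b a
      & balanced A'].
    move=> Axy sym_xy sym_v.
    exists (fun a b => A a b - edge x y a b + edge x v a b + edge v y a b).
    split.
    - move=> a b; do 2![apply: addr_ge0; last exact: edge_ge0].
      exact: sub_edge_ge0.
    - move=> a b; have := AN3 a b; have := sym_xy a b; have := sym_v a b.
      by rewrite /N3; lia.
    move=> z; have := balA z; rewrite /= !(sumiB, sumiD).
    rewrite !sum_edge_row !sum_edge_col.
    by case: (z == x); case: (z == v); case: (z == y) => /=; lia.
  (* [N3] contains the new edge between [u] and [w], so [A] orients a copy of it one way or the
     other. *)
  have : 0 < A u w + A w u.
    by rewrite AN3 ltr_wpDr // /N3 ltr_wpDl // /edge !eqxx.
  have [Auw _|Auw Awu] := ltP 0 (A u w).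
    apply: (subdivide u w Auw) => // a b.
    by rewrite (edgeC u v a) (edgeC u v b); lia.
  apply: (subdivide w u); first by lia.
  - by move=> a b; rewrite (edgeC w u a) (edgeC w u b); lia.
  by move=> a b; rewrite (edgeC w v a) (edgeC w v b); lia.
move=> leM M0.
have [/existsP[v]|/existsPn out1] := boolP [exists v, 1 < \sum_b M v b].
  exact: split_off.
have [/existsP[v]|/existsPn in1] := boolP [exists v, 1 < \sum_a M a v].
  move=> in_v; have [||A [A0 AM balA]] := split_off (fun a b => M b a) v _ _ in_v.
  - by move=> a b.
  - by rewrite exchange_big.
  by exists A; split=> // a b; rewrite AM addrC.
(* All in- and out-degrees are now 0 or 1, so [M] is already balanced. *)
exists M; split=> // v; have := out1 v; have := in1 v.
have : 0 <= \sum_b M v b by apply: sumr_ge0.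
have : 0 <= \sum_a M a v by apply: sumr_ge0.
lia.
Qed.

(** * König's edge-colouring theorem *)

(** In a balanced orientation, a vertex of degree at most 2 has at most one edge in and one out. The
    two matchings are the edges oriented from [V] to [W] and those from [W] to [V]. *)
Lemma split_matchings (V W : finType) (M : V -> W -> int) :
  (forall a b, 0 <= M a b) ->
  (forall a, \sum_b M a b <= 2) -> (forall b, \sum_a M a b <= 2) ->
  exists M1 M2 : V -> W -> int,
    [/\ forall a b, 0 <= M1 a b /\ 0 <= M2 a b,
        forall a b, M1 a b + M2 a b = M a b,
        forall a, \sum_b M1 a b <= 1 /\ \sum_b M2 a b <= 1
      & forall b, \sum_a M1 a b <= 1 /\ \sum_a M2 a b <= 1].
Proof.
move=> M0 row2 col2.
pose B (x y : (V + W)%type) : int :=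
  if x is inl a then if y is inr b then M a b else 0 else 0.
have [|A [A0 AB balA]] := @balanced_orientation _ B.
  by move=> [a|a] [b|b] /=.
have All a b : A (inl a) (inl b) = 0.
  by have := AB (inl a) (inl b); have := A0 (inl a) (inl b);
     have := A0 (inl b) (inl a); rewrite /=; lia.
have Arr a b : A (inr a) (inr b) = 0.
  by have := AB (inr a) (inr b); have := A0 (inr a) (inr b);
     have := A0 (inr b) (inr a); rewrite /=; lia.
exists (fun a b => A (inl a) (inr b)), (fun a b => A (inr b) (inl a)).
have AM a b : A (inl a) (inr b) + A (inr b) (inl a) = M a b.
  by rewrite AB /= addr0.
have outl a : \sum_y A (inl a) y = \sum_b A (inl a) (inr b).
  by rewrite big_sumType /= (eq_bigr _ (fun b _ => All a b)) big1_eq add0r.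
have inl_ a : \sum_x A x (inl a) = \sum_b A (inr b) (inl a).
  by rewrite big_sumType /= (eq_bigr _ (fun b _ => All b a)) big1_eq add0r.
have outr b : \sum_y A (inr b) y = \sum_a A (inr b) (inl a).
  by rewrite big_sumType /= (eq_bigr _ (fun a _ => Arr b a)) big1_eq addr0.
have inr_ b : \sum_x A x (inr b) = \sum_a A (inl a) (inr b).
  by rewrite big_sumType /= (eq_bigr _ (fun a _ => Arr a b)) big1_eq addr0.
split=> // [a|b].
- have := balA (inl a); have := row2 a; rewrite outl inl_.
  by rewrite -(eq_bigr _ (fun b _ => AM a b)) sumiD; lia.
have := balA (inr b); have := col2 b; rewrite outr inr_.
by rewrite -(eq_bigr _ (fun a _ => AM a b)) sumiD; lia.
Qed.

Lemma konig_decomposition (V W I : finType) (A : V -> W -> int) :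
  (forall a b, 0 <= A a b) ->
  (forall a, \sum_b A a b <= #|I|%:Z) -> (forall b, \sum_a A a b <= #|I|%:Z) ->
  exists F : I -> V -> W -> int,
    [/\ forall h a b, 0 <= F h a b,
        forall a b, \sum_h F h a b = A a b,
        forall h a, \sum_b F h a b <= 1
      & forall h b, \sum_a F h a b <= 1].
Proof.
have [n] := ubnP `|(\sum_a \sum_b A a b)%R|%N; elim: n A => // n IHn A leA A0 rowA colA.
have sumA_ge0 : 0 <= \sum_a \sum_b A a b by apply: sumr_ge0 => a _; apply: sumr_ge0.
have [sumA_gt0|sumA_le0] := ltP 0 (\sum_a \sum_b A a b); last first.
  exists (fun _ _ _ => 0); split=> //; try by move=> *; rewrite big1.
  move=> a b; rewrite big1 //; apply/eqP; rewrite eq_sym eq_le A0 andbT.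
  apply: le_trans sumA_le0; rewrite (bigD1 a) //= (bigD1 b) //= -addrA ler_wpDr //.
  by rewrite addr_ge0 ?sumr_ge0 // => i _; apply: sumr_ge0.
have [a0 /sum_gt0_ex[b0 Aab]] := sum_gt0_ex sumA_gt0.
pose A' a b := A a b - edge a0 b0 a b.
have rowA' a : \sum_b A' a b = \sum_b A a b - (a == a0)%:Z.
  by rewrite sumiB sum_edge_row.
have colA' b : \sum_a A' a b = \sum_a A a b - (b == b0)%:Z.
  by rewrite sumiB sum_edge_col.
have sumA' : \sum_a \sum_b A' a b = \sum_a \sum_b A a b - 1.
  by rewrite (eq_bigr _ (fun a _ => sumiB _ _)) sumiB sum_edge.
have [||||F [F0 FA' rowF colF]] := IHn A'.
- by rewrite sumA'; lia.
- exact: sub_edge_ge0.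
- by move=> a; rewrite rowA'; have := rowA a; lia.
- by move=> b; rewrite colA'; have := colA b; lia.
(* Without the new edge, [a0] has degree below [#|I|], so some colour misses it. *)
have [h rowh] : exists h, \sum_b F h a0 b = 0.
  apply: sum_lt_card_ex0 => [h|]; first exact: sumr_ge0.
  rewrite exchange_big (eq_bigr _ (fun b _ => FA' a0 b)) rowA' eqxx.
  by have := rowA a0; lia.
have [k colk] : exists k, \sum_a F k a b0 = 0.
  apply: sum_lt_card_ex0 => [k|]; first exact: sumr_ge0.
  rewrite exchange_big (eq_bigr _ (fun a _ => FA' a b0)) colA' eqxx.
  by have := colA b0; lia.
have [eq_hk|neq_hk] := eqVneq k h.
  rewrite {k}eq_hk in colk.
  exists (fun i a b => F i a b + (if i == h then edge a0 b0 a b else 0)); split.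
  - by move=> i a b; rewrite addr_ge0 //; case: ifP => // _; apply: edge_ge0.
  - by move=> a b; rewrite sumiD FA' -big_mkcond big_pred1_eq subrK.
  - move=> i a; have := rowF i a; rewrite sumiD.
    have [->|_] := eqVneq i h; last by rewrite /= big1_eq addr0.
    by rewrite /= sum_edge_row; have [->|_] := eqVneq a a0; rewrite ?rowh ?addr0.
  move=> i b; have := colF i b; rewrite sumiD.
  have [->|_] := eqVneq i h; last by rewrite /= big1_eq addr0.
  by rewrite /= sum_edge_col; have [->|_] := eqVneq b b0; rewrite ?colk ?addr0.
(* Degrees stay at most 2: at [a0] colour [h] is absent and at [b0] colour [k] is, which makes room
   for the new edge. *)
pose M a b := F h a b + F k a b + edge a0 b0 a b.
have [|||M1 [M2 [M0 MM rowM colM]]] := @split_matchings _ _ M.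
- by move=> a b; rewrite !addr_ge0 ?edge_ge0.
- move=> a; rewrite !sumiD sum_edge_row; have := rowF h a; have := rowF k a.
  by have [->|_] := eqVneq a a0; rewrite ?rowh; lia.
- move=> b; rewrite !sumiD sum_edge_col; have := colF h b; have := colF k b.
  by have [->|_] := eqVneq b b0; rewrite ?colk; lia.
have sum_hk (f : I -> int) :
    \sum_i f i = f h + (f k + \sum_(i | (i != h) && (i != k)) f i).
  by rewrite (bigD1 h) //= (bigD1 k).
exists (fun i => if i == h then M1 else if i == k then M2 else F i).
have M10 a b := proj1 (M0 a b); have M20 a b := proj2 (M0 a b).
split=> [i a b|a b|i a|i b].
- by case: ifP => // _; case: ifP.
- rewrite sum_hk /= !eqxx (negbTE neq_hk) (eq_bigr (fun i => F i a b)).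
    rewrite -[A a b](subrK (edge a0 b0 a b)) -/(A' a b) -FA' sum_hk addrA MM.
    by rewrite addrAC addrA.
  by move=> i /andP[/negbTE-> /negbTE->].
- by have [] := rowM a; case: ifP => // _; case: ifP.
by have [] := colM b; case: ifP => // _; case: ifP.
Qed.

(** * Application to clusters with [tau] equal to 2 *)

(** Shared by both halves of the theorem: a leaf meets spine [h] once through its row of [F h] and
    once through its column, whence the bound 2. The Pod condition follows from the symmetry of
    [heuristic_step3] in the two leaves. *)
Lemma unpolarized_of_matchings (c : cluster) (L A : leaf_matrix c)
    (F : 'I_(nspine c) -> leaf_matrix c) :
  tau c = 2%N ->
  (forall a b, L a b = A a b + A b a) ->
  (forall a b, A a b = \sum_h F h a b) ->
  (forall h a, \sum_b F h a b <= 1) -> (forall h b, \sum_a F h a b <= 1) ->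
  unpolarized L (heuristic_step3 F).
Proof.
move=> tau2 LA AF rowF colF; rewrite /unpolarized /heuristic_step3 tau2.
split=> [a b|a h|b h|i j h].
- by rewrite sumiD -!AF -LA.
- by rewrite sumiD; have := rowF h a; have := colF h a; lia.
- by rewrite sumiD; have := rowF h b; have := colF h b; lia.
by do 2![apply: eq_bigr => ? _]; rewrite addrC.
Qed.

Lemma between_floor_ceil_le (q : rat) (m n : int) :
  q <= n%:~R -> between_floor_ceil q m -> m <= n.
Proof. by move=> qn /andP[_ /le_trans]; apply; rewrite ceil_le_int. Qed.

Lemma nspine_gt0 (c : cluster) : (0 < nspine c)%N.
Proof. by rewrite divn_gt0 ?tau_gt0 // dvdn_leq ?Kleaf_gt0 ?tau_dvd_Kleaf. Qed.

Lemma Kleaf_nspine (c : cluster) : tau c = 2%N -> Kleaf c = (2 * nspine c)%N.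
Proof.
by move=> tau2; rewrite -[in LHS](divnK (tau_dvd_Kleaf c)) tau2 mulnC -tau2.
Qed.

Lemma step1_sum_le (c : cluster) (s m : int) :
  tau c = 2%N ->
  s <= (Kleaf c)%:Z -> between_floor_ceil (s%:~R / 2%:R) m -> m <= (nspine c)%:Z.
Proof.
move=> /Kleaf_nspine-> les; apply: between_floor_ceil_le.
by rewrite ler_pdivrMr ?ltr0n // -[2%:R]/(2%:~R) -intrM ler_int; lia.
Qed.

Lemma step2_sum_le1 (c : cluster) (s m : int) :
  s <= (nspine c)%:Z -> between_floor_ceil (s%:~R / (nspine c)%:R) m -> m <= 1.
Proof.
move=> les; apply: between_floor_ceil_le.
by rewrite ler_pdivrMr ?ltr0n ?nspine_gt0 // mul1r -[_%:R]/(nspine c)%:~R ler_int.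
Qed.

(** Step 1 halves line sums bounded by [2 * nspine c], and step 2 divides the result by [nspine c].
    Both bounds are integers, so rounding up cannot exceed them. *)
Lemma heuristic_unpolarized (c : cluster) (L : leaf_matrix c)
    (x : leaf_spine_array c) :
  tau c = 2%N ->
  leaf_requirement L -> heuristic_solution L x -> unpolarized L x.
Proof.
move=> tau2 [_ _ _ rowL colL] [A [F [[_ LA rowA colA] [AF _ colF rowF] xF]]].
have [||sumx rowx colx podx] := @unpolarized_of_matchings c L A F tau2 LA AF.
- by move=> h a; apply: step2_sum_le1 (rowF a h); apply: step1_sum_le tau2 _ (rowA a).
- by move=> h b; apply: step2_sum_le1 (colF b h); apply: step1_sum_le tau2 _ (colA b).
split=> [a b|a h|b h|i j h].
- by under eq_bigr do rewrite xF.
- by under eq_bigr do rewrite xF.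
- by under eq_bigr do rewrite xF.
have := podx i j h; under eq_bigr do under eq_bigr do rewrite -xF.
by move=> ->; apply: eq_bigr => a _; apply: eq_bigr => b _; rewrite xF.
Qed.

Lemma schedulable_exists (c : cluster) (L : leaf_matrix c) :
  tau c = 2%N ->
  leaf_requirement L -> exists C : logical_topology c, schedulable_unpolarized L C.
Proof.
move=> tau2 [L0 symL podL rowL _].
(* Each unordered pair of leaves is counted once; the diagonal of [L] vanishes because a leaf shares
   its own Pod. *)
pose M a b : int := if (enum_rank a < enum_rank b)%N then L a b else 0.
have [|A [A0 AM balA]] := @balanced_orientation _ M.
  by move=> a b; rewrite /M; case: ifP.
have LA a b : L a b = A a b + A b a.
  rewrite AM /M; case: ltngtP => [_|_|/val_inj/enum_rank_inj eq_ab].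
  - by rewrite addr0.
  - by rewrite add0r.
  by rewrite addr0 podL // eq_ab.
(* The two sums total at most [2 * nspine c] and differ by at most 1; the evenness of this bound
   excludes a sum of [nspine c + 1]. *)
have degA a : \sum_b A a b <= (nspine c)%:Z /\ \sum_b A b a <= (nspine c)%:Z.
  have := rowL a; rewrite (eq_bigr _ (fun b _ => LA a b)) sumiD Kleaf_nspine //.
  by have := balA a; lia.
have [|||F [F0 FA rowF colF]] := @konig_decomposition _ _ 'I_(nspine c) A.
- exact: A0.
- by move=> a; rewrite card_ord; case: (degA a).
- by move=> a; rewrite card_ord; case: (degA a).
exists (topology_of (heuristic_step3 F)), (heuristic_step3 F); split=> //.
- by move=> a b h; rewrite addr_ge0.
by apply: (@unpolarized_of_matchings c L A F).
Qed.

Theorem mainTheorem2 (c : cluster) (tau2 : tau c = 2%N)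
    (L : leaf_matrix c) (hL : leaf_requirement L) :
  (forall x : leaf_spine_array c, heuristic_solution L x -> unpolarized L x) /\
  (exists C : logical_topology c, schedulable_unpolarized L C).
Proof.
split; last exact: schedulable_exists.
by move=> x; apply: heuristic_unpolarized.
Qed.
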